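(* The category $\mathbf{Cov}$ of cover spaces and cover maps, with its forgetful functor to $\mathbf{Set}$, is a topological category: for every set $X$, every family $(Y_i)_{i\in I}$ of cover spaces (of arbitrary size) and every family of functions $f_i : X \to Y_i$, there is a unique cover space structure on $X$ that is initial with respect to $(f_i)_{i \in I}$, i.e. such that every $f_i$ is a cover map and, for every cover space $Z$ and every function $g : Z \to X$, $g$ is a cover map whenever all composites $f_i \circ g$ are cover maps.
   Context: Conventions: constructive mathematics (internal language of an elementary topos). For subsets $U,V$ of a set, $U \between V$ means that there exists an element belonging to both. A cover of a set $X$ is a set $C$ of subsets of $X$ with $\bigcup C = X$; $C$ refines $D$ if every element of $C$ is a subset of some element of $D$. A cover space is a set $X$ with a collection $\mathcal{C}_X$ of covers of $X$ (called Cauchy covers) such that: (CT) $\{X\} \in \mathcal{C}_X$; (CE) if $C \in \mathcal{C}_X$ and $C$ refines $D$, then $D \in \mathcal{C}_X$; (CG) if $C \in \mathcal{C}_X$ and $D_U \in \mathcal{C}_X$ for every $U \in C$, then $\{U \cap V \mid U \in C, V \in D_U\} \in \mathcal{C}_X$; (CR) if $C \in \mathcal{C}_X$, then $\{V \subseteq X \mid \exists U \in C,\ V \prec_X U\} \in \mathcal{C}_X$, where $V \prec_X U$ means $\{W \subseteq X \mid W \between V \Rightarrow W \subseteq U\} \in \mathcal{C}_X$. A cover map $f : X \to Y$ is a function such that for every Cauchy cover $D$ of $Y$, $\{f^{-1}(V) \mid V \in D\}$ is a Cauchy cover of $X$. ''Topological category'' is meant in the sense of Adámek–Herrlich–Strecker: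 every structured source has a unique initial lift. *)

(* Defs.v *)
From mathcomp Require Import all_boot.
From mathcomp Require Import boolp classical_sets.

Set Implicit Arguments.
Unset Strict Implicit.
Unset Printing Implicit Defensive.

Local Open Scope classical_set_scope.

Definition covers (X : Type) (C : set (set X)) : Prop :=
  \bigcup_(U in C) U = [set: X].

Definition refines (X : Type) (C D : set (set X)) : Prop :=
  forall U, C U -> exists2 V, D V & U `<=` V.

(* [prec K V U] is the relation V \prec U determined by a collection [K] of
   covers; it is defined for an arbitrary [K] so that it can occur in the
   axioms below. *)
Definition prec (X : Type) (K : set (set (set X))) (V U : set X) : Prop :=
  K [set W | W `&` V !=set0 -> W `<=` U].

(* In [cauchy_glue] the family (D_U) is indexed by all subsets U, but only its
   members with U in C matter: any family indexed by the elements U of C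
   extends to [fun U => [set V | exists CU : C U, D U CU V]]. *)
Record cover_structure (X : Type) : Type := CoverStructure {
  cauchy : set (set (set X));
  cauchy_covers : forall C, cauchy C -> covers C;
  cauchy_setT : cauchy [set [set: X]];
  cauchy_refines : forall C D, cauchy C -> refines C D -> cauchy D;
  cauchy_glue : forall (C : set (set X)) (D : set X -> set (set X)),
    cauchy C -> (forall U, C U -> cauchy (D U)) ->
    cauchy (\bigcup_(U in C) [set U `&` V | V in D U]);
  cauchy_regular : forall C,
    cauchy C -> cauchy [set V | exists2 U, C U & prec cauchy V U] }.

Definition cover_map (X Y : Type) (S : cover_structure X)
    (T : cover_structure Y) (f : X -> Y) : Prop :=
  forall D, cauchy T D -> cauchy S [set f @^-1` V | V in D].

(* A concrete category over the category of types and functions, presented by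
   its fibres: an object is a type [X] with an element of [str X], a morphism
   is a function satisfying [mor], and the forgetful functor (faithful by
   construction) drops the structure. *)
Record concrete_category : Type := ConcreteCategory {
  str : Type -> Type;
  mor : forall X Y : Type, str X -> str Y -> (X -> Y) -> Prop;
  mor_id : forall (X : Type) (S : str X), mor S S (fun x => x);
  mor_comp : forall (X Y Z : Type) (S : str X) (T : str Y) (R : str Z)
    (f : X -> Y) (g : Y -> Z),
    mor S T f -> mor T R g -> mor S R (fun x => g (f x)) }.

Definition initial (A : concrete_category) (X I : Type) (Y : I -> Type)
    (T : forall i, str A (Y i)) (f : forall i, X -> Y i) (S : str A X) : Prop :=
  (forall i, mor S (T i) (f i)) /\
  (forall (Z : Type) (R : str A Z) (g : Z -> X),
     (forall i, mor R (T i) (fun z => f i (g z))) -> mor R S g).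

Definition topological (A : concrete_category) : Prop :=
  forall (X I : Type) (Y : I -> Type) (T : forall i, str A (Y i))
    (f : forall i, X -> Y i),
  exists! S : str A X, initial T f S.

Lemma cover_map_id (X : Type) (S : cover_structure X) :
  cover_map S S (fun x => x).
Proof.
move=> D SD; apply: (cauchy_refines SD) => U DU.
by exists U => //; exists U.
Qed.

Lemma cover_map_comp (X Y Z : Type) (S : cover_structure X)
    (T : cover_structure Y) (R : cover_structure Z) (f : X -> Y) (g : Y -> Z) :
  cover_map S T f -> cover_map T R g -> cover_map S R (fun x => g (f x)).
Proof.
move=> fST gTR D RD; apply: (cauchy_refines (fST _ (gTR _ RD))).
move=> _ [_ [V DV <-] <-].
by exists ((fun x => g (f x)) @^-1` V) => //; exists V.
Qed.

Definition Cov : concrete_category :=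
  ConcreteCategory cover_map_id cover_map_comp.

(* Main.v *)
From mathcomp Require Import all_boot.
From mathcomp Require Import boolp classical_sets.
Require Import Defs.

Set Implicit Arguments.
Unset Strict Implicit.
Unset Printing Implicit Defensive.

Local Open Scope classical_set_scope.

(** The initial structure on [X] is the least collection of covers that contains
    the preimages of the Cauchy covers of all the [Y i] and is closed under the
    trivial cover, refinement and gluing, i.e. under every axiom except
    regularity.  The point is that regularity then comes for free
    ([generated_regular]): each closure rule transports the regularity
    property from its premises to its conclusion, and the preimage of
    a Cauchy cover has it because preimages preserve the relation [prec]
    ([prec_preimage]).

    Initiality is an induction on the generation ([generated_preimage]): the
    covers of [X] whose preimage along [g] is Cauchy are closed under the same
    rules.  Uniqueness is the usual antisymmetry: the identity is a cover map
    in both directions between two initial structures, so they have the same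
    Cauchy covers, and a structure is determined by these. *)

Lemma cover_structure_eq (X : Type) (S S' : cover_structure X) :
  cauchy S = cauchy S' -> S = S'.
Proof.
case: S S' => [K a b c d e] [K' a' b' c' d' e'] /= KK'.
by subst K'; congr CoverStructure; exact: Prop_irrelevance.
Qed.

Lemma cover_map_id_sub (X : Type) (S S' : cover_structure X) :
  cover_map S S' (fun x => x) -> cauchy S' `<=` cauchy S.
Proof.
move=> SS' C S'C; apply: (cauchy_refines (SS' _ S'C)).
by move=> _ [V CV <-]; exists V.
Qed.

Section Generated.
Variables (X : Type) (B : set (set (set X))).

Inductive generated : set (set X) -> Prop :=
| generated_base C : B C -> generated C
| generated_setT : generated [set [set: X]]
| generated_refines C D : generated C -> refines C D -> generated D
| generated_glue (C : set (set X)) (D : set X -> set (set X)) :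
    generated C -> (forall U, C U -> generated (D U)) ->
    generated (\bigcup_(U in C) [set U `&` V | V in D U]).

Lemma generated_covers :
  (forall C, B C -> covers C) -> forall C, generated C -> covers C.
Proof.
move=> BC C; elim=> {C} [C /BC//| |C D _ Ccov CD|C D _ Ccov _ Dcov].
- by rewrite /covers bigcup_set1.
- rewrite /covers -subTset -Ccov => x [U CU Ux].
  by have [V DV UV] := CD _ CU; exists V => //; exact: UV.
- rewrite /covers -subTset => x; rewrite -{1}Ccov => -[U CU Ux].
  have : [set: X] x by [].
  rewrite -(Dcov _ CU) => -[V DV Vx].
  by exists (U `&` V) => //; exists U => //; exists V.
Qed.

Lemma prec_subr (V U U' : set X) :
  U `<=` U' -> prec generated V U -> prec generated V U'.
Proof.
move=> UU' VU; apply: (generated_refines VU) => W WVU.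
by exists W => // /WVU WU; exact: subset_trans UU'.
Qed.

(** When [A1] belongs to the cover witnessing [V1 \prec U1] and [A2] to the one
    witnessing [V2 \prec U2], a point of [A1 `&` A2] in [V1 `&` V2] forces both
    [A1 `<=` U1] and [A2 `<=` U2]; so the common refinement of the two witnessing
    covers, which gluing provides, witnesses the conclusion. *)
Lemma prec_setI (V1 U1 V2 U2 : set X) :
  prec generated V1 U1 -> prec generated V2 U2 ->
  prec generated (V1 `&` V2) (U1 `&` U2).
Proof.
move=> VU1 VU2; have := generated_glue VU1 (fun _ _ => VU2).
move/generated_refines; apply=> _ [A1 A1P [A2 A2P <-]].
exists (A1 `&` A2) => // -[x [[A1x A2x] [V1x V2x]]].
by apply: setISS; [apply: A1P|apply: A2P]; exists x.
Qed.

Definition interiors (C : set (set X)) : set (set X) :=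
  [set V | exists2 U, C U & prec generated V U].

(** Regularity of the base suffices.  In the gluing case a member of the cover is
    [U `&` U'] with [U'] in [D U]; gluing the interiors of [C] with those of the
    covers [D U] gives sets [V `&` W] with [V \prec U] and [W \prec U'], to which
    [prec_setI] applies. *)
Lemma generated_regular :
  (forall C, B C -> generated (interiors C)) ->
  forall C, generated C -> generated (interiors C).
Proof.
move=> Breg C; elim=> {C} [C /Breg//| |C D _ IHC CD|C D _ IHC _ IHD].
- apply: (generated_refines generated_setT) => _ ->.
  exists setT => //; exists setT => //.
  by apply: (generated_refines generated_setT) => W _; exists setT.
- apply: (generated_refines IHC) => V [U CU VU].
  have [U' DU' UU'] := CD _ CU; exists V => //.
  by exists U' => //; exact: prec_subr VU.
- (* The cover glued over [V] collects the interiors of [D U] for all the [U]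
     with [V \prec U] together, so that no choice of such a [U] is made. *)
  pose E V := [set W | exists U, [/\ C U, prec generated V U & interiors (D U) W]].
  have EV V : interiors C V -> generated (E V).
    move=> [U CU VU]; apply: (generated_refines (IHD _ CU)) => W DW.
    by exists W => //; exists U.
  apply: (generated_refines (generated_glue IHC EV)).
  move=> _ [V _ [W [U [CU VU [U' DU' WU']]] <-]].
  exists (V `&` W) => //; exists (U `&` U'); last exact: prec_setI.
  by exists U => //; exists U'.
Qed.

Lemma generated_preimage (Z : Type) (R : cover_structure Z) (g : Z -> X) :
  (forall C, B C -> cauchy R [set g @^-1` V | V in C]) ->
  forall C, generated C -> cauchy R [set g @^-1` V | V in C].
Proof.
move=> BR C; elim=> {C} [C /BR//| |C D _ IHC CD|C D _ IHC _ IHD].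
- apply: (cauchy_refines (cauchy_setT R)) => _ ->.
  by exists setT => //; exists setT.
- apply: (cauchy_refines IHC) => _ [U CU <-].
  have [V DV UV] := CD _ CU; exists (g @^-1` V); first by exists V.
  exact: preimage_subset.
- (* Distinct members of [C] may have the same preimage [P], so the cover glued
     over [P] has to gather the preimages of [D U] for all of them. *)
  pose E P := [set Q | exists U, [/\ C U, g @^-1` U = P &
                                     [set g @^-1` V | V in D U] Q]].
  have EP P : [set g @^-1` U | U in C] P -> cauchy R (E P).
    move=> [U CU UP]; apply: (cauchy_refines (IHD _ CU)) => Q DQ.
    by exists Q => //; exists U.
  apply: (cauchy_refines (cauchy_glue IHC EP)).
  move=> _ [_ _ [_ [U [CU <- [V DV <-]]] <-]].
  exists (g @^-1` (U `&` V)) => //.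
  by exists (U `&` V) => //; exists U => //; exists V.
Qed.

Definition generated_structure (Bcov : forall C, B C -> covers C)
    (Breg : forall C, B C -> generated (interiors C)) : cover_structure X :=
  CoverStructure (generated_covers Bcov) generated_setT generated_refines
    generated_glue (generated_regular Breg).

End Generated.

Lemma covers_preimage (X Y : Type) (f : X -> Y) (D : set (set Y)) :
  covers D -> covers [set f @^-1` V | V in D].
Proof.
rewrite /covers -!subTset => Dcov x _.
by have [V DV Vfx] := Dcov (f x) I; exists (f @^-1` V) => //; exists V.
Qed.

Section Initial.
Variables (X I : Type) (Y : I -> Type).
Variables (T : forall i, cover_structure (Y i)) (f : forall i, X -> Y i).

Definition preimage_covers : set (set (set X)) :=
  [set C | exists i, exists2 D, cauchy (T i) D & [set f i @^-1` V | V in D] = C].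

Lemma preimage_covers_generated i D :
  cauchy (T i) D -> generated preimage_covers [set f i @^-1` V | V in D].
Proof. by move=> TD; apply: generated_base; exists i, D. Qed.

(** If [f^-1 W] meets [f^-1 V] then [W] meets [V]; hence the preimage of a cover
    witnessing [V \prec U] witnesses the same relation for the preimages. *)
Lemma prec_preimage i (V U : set (Y i)) :
  prec (cauchy (T i)) V U ->
  prec (generated preimage_covers) (f i @^-1` V) (f i @^-1` U).
Proof.
move=> /preimage_covers_generated/generated_refines; apply => _ [W WVU <-].
exists (f i @^-1` W) => // -[x [Wx Vx]].
by apply: preimage_subset; apply: WVU; exists (f i x).
Qed.

Lemma preimage_covers_cover C : preimage_covers C -> covers C.
Proof. by move=> [i [D TD <-]]; exact/covers_preimage/(cauchy_covers TD). Qed.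

Lemma preimage_covers_regular C :
  preimage_covers C ->
  generated preimage_covers (interiors preimage_covers C).
Proof.
move=> [i [D TD <-]].
have := preimage_covers_generated (cauchy_regular TD).
move/generated_refines; apply => _ [V [U DU VU] <-].
exists (f i @^-1` V) => //; exists (f i @^-1` U); first by exists U.
exact: prec_preimage.
Qed.

Definition initial_structure : cover_structure X :=
  generated_structure preimage_covers_cover preimage_covers_regular.

Lemma initial_structureP : @initial Cov X I Y T f initial_structure.
Proof.
split=> [i D TD|Z R g gR]; first exact: preimage_covers_generated.
apply: generated_preimage => _ [i [D TD <-]].
apply: (cauchy_refines (gR i _ TD)) => _ [V DV <-].
exists (g @^-1` (f i @^-1` V)) => //.
by exists (f i @^-1` V) => //; exists V.
Qed.

Lemma initial_unique (S S' : cover_structure X) :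
  @initial Cov X I Y T f S -> @initial Cov X I Y T f S' -> S = S'.
Proof.
move=> [fS Sinit] [fS' S'init]; apply: cover_structure_eq.
by apply/seteqP; split; apply: cover_map_id_sub;
  [exact: Sinit|exact: S'init].
Qed.

End Initial.

Theorem corollary3p4 : topological Cov.
Proof.
move=> X I Y T f; exists (initial_structure T f).
by split=> [|S]; [exact: initial_structureP|exact/initial_unique/initial_structureP].
Qed.
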